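(* Let $n\ge 8$. Then the set $\{\eta(\Gamma(G)) : \Gamma(G) \text{ an unbalanced signed graph with } G\in B_n^{++}\}$ equals $\{0,1,2,\ldots,n-6\}$.
   Context: A signed graph $\Gamma(G)=(G,\sigma)$ consists of a simple graph $G$ and a map $\sigma:E(G)\to\{+,-\}$; its adjacency matrix has entry $\sigma(v_iv_j)$ for edges and $0$ otherwise, and $\eta(\Gamma(G))$ is the multiplicity of $0$ as an eigenvalue. A cycle is positive if it has an even number of negative edges; $\Gamma(G)$ is balanced if all its cycles are positive, and unbalanced otherwise. A bicyclic graph is a connected simple graph with $|E|=|V|+1$. The graph $\infty(p,q,1)$ ($p,q\ge3$) is obtained from vertex-disjoint cycles $C_p$, $C_q$ by identifying a vertex of $C_p$ with a vertex of $C_q$. $B_n^{++}$ is the set of bicyclic graphs on $n$ vertices obtained from some $\infty(p,q,1)$ by (possibly) attaching trees to some of its vertices. *)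

(* Defs.v *)
From mathcomp Require Import all_boot all_order all_algebra.

Set Implicit Arguments.
Unset Strict Implicit.
Unset Printing Implicit Defensive.

Import GRing.Theory Num.Theory.

Record sgraph (T : finType) := SGraph {
  adj : rel T;
  adj_sym : symmetric adj;
  adj_irr : irreflexive adj
}.

Definition edges (T : finType) (G : sgraph T) : {set {set T}} :=
  [set e : {set T} | [exists x, exists y, adj G x y && (e == [set x; y])]].

(* [neg G e] is [true] when the edge [e] has sign -; the values of [neg G] on
   sets that are not edges are never used. *)
Record signed_graph (T : finType) := SignedGraph {
  underlying :> sgraph T;
  neg : {set T} -> bool
}.

Definition adjacency (R : pzRingType) (n : nat) (G : signed_graph 'I_n) :
    'M[R]_n :=
  \matrix_(i, j) (if adj G i j then (-1) ^+ neg G [set i; j] else 0)%R.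

(* Algebraic multiplicity; the matrix is symmetric with entries 0, 1, -1, so it agrees with the
   geometric one. *)
Definition nullity (R : numFieldType) (n : nat) (G : signed_graph 'I_n) : nat :=
  mup 0%R (char_poly (adjacency R G)).

Definition is_cycle (T : finType) (G : sgraph T) (c : seq T) : bool :=
  ucycleb (adj G) c && (2 < size c).

Definition cycle_edges (T : finType) (c : seq T) : seq {set T} :=
  [seq [set x; next c x] | x <- c].

Definition positive_cycle (T : finType) (G : signed_graph T) (c : seq T) :
    bool :=
  ~~ odd (count (neg G) (cycle_edges c)).

Definition balanced (T : finType) (G : signed_graph T) : Prop :=
  forall c : seq T, is_cycle G c -> positive_cycle G c.

Definition unbalanced (T : finType) (G : signed_graph T) : Prop :=
  ~ balanced G.

Definition bicyclic (T : finType) (G : sgraph T) : Prop :=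
  (forall x y : T, connect (adj G) x y) /\ #|edges G| = #|T| + 1.

(* The subgraph of G induced on A is a tree. *)
Definition induces_tree (T : finType) (G : sgraph T) (A : {set T}) : Prop :=
  [/\ A != set0,
      forall x y : T, x \in A -> y \in A ->
        connect [rel u v | [&& u \in A, v \in A & adj G u v]] x y
    & forall c : seq T, is_cycle G c -> ~~ all [in A] c].

(* Adjacency in the cycle graph C_p on 'I_p, for p >= 3. *)
Definition Cadj (p : nat) : rel 'I_p :=
  [rel i j : 'I_p | (j == i.+1 %% p :> nat) || (i == j.+1 %% p :> nat)].

(* Vertices of the graph obtained from disjoint C_p and C_q by identifying the
   vertex i0 of C_p with the vertex j0 of C_q: [None] is the merged vertex. *)
Definition infty_vertex (p q : nat) : finType := option ('I_p.-1 + 'I_q.-1).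

Definition infty_inl (p q : nat) (i0 i : 'I_p) : infty_vertex p q :=
  omap inl (unlift i0 i).

Definition infty_inr (p q : nat) (j0 j : 'I_q) : infty_vertex p q :=
  omap inr (unlift j0 j).

(* Adjacency in the graph oo(p,q,1) so obtained. *)
Definition infty_adj (p q : nat) (i0 : 'I_p) (j0 : 'I_q) :
    rel (infty_vertex p q) :=
  [rel s t |
    [exists i, exists i',
      [&& Cadj i i', infty_inl q i0 i == s & infty_inl q i0 i' == t]]
    || [exists j, exists j',
      [&& Cadj j j', infty_inr p j0 j == s & infty_inr p j0 j' == t]]].

(* G is a graph with vertex set W and adjacency h to each vertex s of which a
   (possibly one-vertex) tree has been attached, by identifying s with a vertex
   of that tree: f embeds W in G, and the vertices of the tree attached at s
   are the x such that r x = s. *)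
Definition trees_attached (T W : finType) (h : rel W) (G : sgraph T) : Prop :=
  exists (f : W -> T) (r : T -> W),
    [/\ cancel f r,
        forall s t : W, adj G (f s) (f t) = h s t,
        forall x y : T, adj G x y ->
          r x = r y \/ (x = f (r x) /\ y = f (r y))
      & forall s : W, induces_tree G [set x | r x == s]].

(* The class B_n^{++}, where n = #|T|. *)
Definition Bpp (T : finType) (G : sgraph T) : Prop :=
  bicyclic G /\
  exists (p q : nat) (i0 : 'I_p) (j0 : 'I_q),
    [/\ 3 <= p, 3 <= q & trees_attached (infty_adj i0 j0) G].

(* Main.v *)
Require Import Defs.
From mathcomp Require Import all_boot all_order all_algebra.
From mathcomp Require Import zify.

(* The adjacency matrix A is real symmetric, so A and A^2 have the same rank and
   the nullity is n - rank A.

   Rank at least 6: it suffices to find vertices x1, x2, x3, y3, y2, y1 indexing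
   a principal submatrix that is triangular for the antidiagonal, the edges
   x_i y_i giving the antidiagonal entries. If a tree vertex w hangs at a vertex
   u of one cycle, take the edge w u, an edge of that cycle avoiding u, and an
   edge of the other cycle avoiding the common vertex. If there is no tree
   vertex, then p + q - 1 = n >= 8 forces p >= 5 or q >= 5, and the cycles minus
   the common vertex contain an induced path on four vertices and an edge of the
   other cycle.

   Every rank from 6 to n occurs: join two negative triangles at a vertex c and
   attach at c a path whose last vertex is duplicated as many times as needed.
   The duplicates give equal rows, and without them the kernel is trivial: the
   triangles force the value 4z at the neighbour of c on the path, where z is
   the value at c, while the leaf equation, propagated backwards, kills one of
   these two values. *)

Set Implicit Arguments.
Unset Strict Implicit.
Unset Printing Implicit Defensive.
Import Order.TTheory GRing.Theory Num.Theory.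

(** * Nullity and rank *)

Section Nullity.
Local Open Scope ring_scope.

(** Both sides equal ['X^r * \det M] for the block matrix [M] with rows [('X, C)] and [(B, 1)]:
    eliminating [B] by a factor on the right or on the left produces the two characteristic
    polynomials. *)
Lemma char_poly_mulmxC (F : comNzRingType) (n r : nat)
    (C : 'M[F]_(n, r)) (B : 'M[F]_(r, n)) :
  'X^r * char_poly (C *m B) = 'X^n * char_poly (B *m C).
Proof.
pose C' := map_mx polyC C; pose B' := map_mx polyC B.
have cpE m (D : 'M[F]_m) : char_poly D = \det ('X%:M - map_mx polyC D) by [].
rewrite !cpE !map_mxM -/B' -/C'.
pose M : 'M_(n + r) := block_mx 'X%:M C' B' 1%:M.
have eM : M *m block_mx 1%:M 0 (- B') 1%:M
    = block_mx ('X%:M - C' *m B') C' 0 1%:M.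
  by rewrite mulmx_block !mulmx1 !mul1mx !mulmxN !mulmx0 add0r addrC subrr
             add0r addrC.
have eM' : block_mx 1%:M 0 (- B') 'X%:M *m M
    = block_mx 'X%:M C' 0 ('X%:M - B' *m C').
  rewrite mulmx_block !mul1mx !mul0mx !addr0 mulmx1 !mulNmx.
  by rewrite -scalar_mxC addrC subrr [_ + 'X%:M]addrC.
have := congr1 determinant eM; have := congr1 determinant eM'.
rewrite !det_mulmx !det_ublock !det_lblock !det1 !det_scalar !mul1r !mulr1.
by move=> <- <-.
Qed.

(** Take the rank factorisation [A = C *m B]. Equal ranks of [A] and its square make the r by r
    matrix [B *m C] invertible, so 0 is no root of its characteristic polynomial, and
    [char_poly_mulmxC] yields the multiplicity. *)
Lemma mup_char_poly (F : fieldType) (n : nat) (A : 'M[F]_n) :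
  \rank (A *m A) = \rank A -> mup 0 (char_poly A) = (n - \rank A)%N.
Proof.
move=> rA2; set r := \rank A.
pose C := col_base A; pose B := row_base A.
have uBC : B *m C \in unitmx.
  rewrite -row_full_unit /row_full eqn_leq rank_leq_row /=.
  apply: (@leq_trans (\rank (A *m A))); first by rewrite rA2.
  rewrite -[in leqLHS](mulmx_base A) -/C -/B mulmxA -[C *m B *m C]mulmxA.
  by rewrite (leq_trans (mxrankM_maxl _ _)) ?mxrankM_maxr.
have /(congr1 (mup 0)) := char_poly_mulmxC C B.
rewrite mulmx_base !mupM ?monic_neq0 ?monicXn ?char_poly_monic //.
have mX k : mup 0 ('X^k : {poly F}) = k.
  by have := mup_XsubCX k (0 : F) 0; rewrite subr0 eqxx.
rewrite !mX [mup 0 (char_poly (B *m C))]mupNroot => [|]; last first.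
  rewrite /root horner_coef0 char_poly_det mulf_eq0 signr_eq0 /=.
  by rewrite -unitfE -unitmxE.
by rewrite addn0 => /(canRL (addKn _)).
Qed.

(** If [x A A^T = 0] then [(x A) (x A)^T = 0], a sum of squares; over a real field [x A = 0], so the
    two kernels agree. *)
Lemma rank_mulmx_tr (F : realFieldType) (m n : nat) (A : 'M[F]_(m, n)) :
  \rank (A *m A^T) = \rank A.
Proof.
apply/eqP; rewrite eqn_leq mxrankM_maxl /=.
have := mxrank_ker (A *m A^T); have := mxrank_ker A.
suff /mxrankS : (kermx (A *m A^T) <= kermx A)%MS.
  move=> le e1 e2; move: le; rewrite e1 e2 leq_sub2lE //; exact: rank_leq_row.
rewrite sub_kermx; apply/eqP; set K := kermx _.
have : K *m A *m (K *m A)^T = 0.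
  by rewrite trmx_mul mulmxA -(mulmxA K) mulmx_ker mul0mx.
move: (K *m A) => D /matrixP D0; apply/matrixP => i j.
have := D0 i i; rewrite !mxE => /eqP; rewrite psumr_eq0 => [/allP/(_ j)|k _].
  by rewrite mem_index_enum mxE -expr2 sqrf_eq0 => /(_ isT) /eqP.
by rewrite mxE -expr2 sqr_ge0.
Qed.

Lemma nullityE (R : numFieldType) (n : nat) (G : signed_graph 'I_n) :
  nullity R G = (n - \rank (adjacency R G))%N.
Proof.
apply: mup_char_poly.
(* [R] may be complex, where a sum of nonzero squares can vanish; the entries are rational, so the
   ranks are computed over [rat]. *)
have -> : adjacency R G = map_mx (ratr : rat -> R) (adjacency rat G).
  by apply/matrixP => i j; rewrite !mxE; case: ifP; rewrite ?rmorph0 ?rmorph_sign.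
rewrite -map_mxM !mxrank_map -[RHS]rank_mulmx_tr; congr (\rank (_ *m _)).
by apply/matrixP => i j; rewrite !mxE adj_sym setUC.
Qed.

Lemma rank_mxsub (F : fieldType) (m n m' n' : nat) (f : 'I_m' -> 'I_m)
    (g : 'I_n' -> 'I_n) (A : 'M[F]_(m, n)) :
  (\rank (mxsub f g A) <= \rank A)%N.
Proof.
rewrite mxsubrc (leq_trans (mxrankS (rowsub_sub _ _))) //.
by rewrite -mxrank_tr trmx_mxsub -[leqRHS]mxrank_tr mxrankS ?rowsub_sub.
Qed.

End Nullity.

(** * Lower bound on the rank *)

(** Reversing the columns yields a lower triangular submatrix with nonzero diagonal. *)
Lemma rank_antitriangular (F : fieldType) (n m : nat) (A : 'M[F]_n)
    (v : 'I_m -> 'I_n) :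
  (forall i j : 'I_m, i + j < m.-1 -> A (v i) (v j) = 0%R) ->
  (forall i, A (v i) (v (rev_ord i)) != 0)%R -> m <= \rank A.
Proof.
move=> A0 Adiag; apply: leq_trans (rank_mxsub v (v \o @rev_ord m) A).
have trig : is_trig_mx (mxsub v (v \o @rev_ord m) A).
  by apply/is_trig_mxP => i j ij; rewrite mxE A0 //=; have := ltn_ord j; lia.
suff /mxrank_unit -> : mxsub v (v \o @rev_ord m) A \in unitmx by [].
rewrite unitmxE unitfE det_trig //; apply/prodf_neq0 => i _.
by rewrite mxE Adiag.
Qed.

Lemma rank_ge6 (R : numFieldType) (n : nat) (G : signed_graph 'I_n)
    (x1 x2 x3 y1 y2 y3 : 'I_n) :
  adj G x1 y1 -> adj G x2 y2 -> adj G x3 y3 ->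
  ~~ adj G x1 x2 -> ~~ adj G x1 x3 -> ~~ adj G x1 y2 -> ~~ adj G x1 y3 ->
  ~~ adj G x2 x3 -> ~~ adj G x2 y3 -> 6 <= \rank (adjacency R G).
Proof.
move=> e1 e2 e3 n12 n13 n12' n13' n23 n23'.
(* The edges x_i y_i fill the antidiagonal; the six non-adjacencies, with symmetry and the absence
   of loops, kill the entries above it. *)
pose v (i : 'I_6) := nth x1 [:: x1; x2; x3; y3; y2; y1] i.
apply: (@rank_antitriangular _ _ _ _ v).
  move=> i j ij; rewrite mxE ifN // /v.
  case: i j ij => [[|[|[|[|[|[|//]]]]]] ?] [[|[|[|[|[|[|//]]]]]] ?] //= _;
    by rewrite ?adj_irr // adj_sym.
move=> i; rewrite mxE ifT ?signr_eq0 // /v.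
by case: i => [[|[|[|[|[|[|//]]]]]] ?] //=; rewrite adj_sym.
Qed.

(* [a] and [b] list the vertices of C_p and C_q in cyclic order, both starting
   at the common vertex. *)
Definition two_cycles (T : finType) (G : sgraph T) (p q : nat)
    (a b : nat -> T) : Prop :=
  [/\ 3 <= p /\ 3 <= q, a 0 = b 0,
      forall k l, k < p -> l < p ->
        adj G (a k) (a l) = (l == k.+1 %% p) || (k == l.+1 %% p),
      forall k l, k < q -> l < q ->
        adj G (b k) (b l) = (l == k.+1 %% q) || (k == l.+1 %% q)
    & forall k l, 0 < k < p -> 0 < l < q -> ~~ adj G (a k) (b l)].

Lemma two_cyclesC (T : finType) (G : sgraph T) p q (a b : nat -> T) :
  two_cycles G p q a b -> two_cycles G q p b a.
Proof.
case=> [[p3 q3] ab0 ha hb hab]; split=> // k l k1 l1.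
by rewrite adj_sym hab.
Qed.

Lemma modS_if p k : k < p -> k.+1 %% p = if k.+1 == p then 0 else k.+1.
Proof.
by move=> kp; case: eqP => [->|?]; rewrite ?modnn // modn_small //; lia.
Qed.

(** As p >= 5, [a 1], ..., [a 4] is an induced path missing the common vertex. Its two end edges are
    used with [b 1], [b 2]; the adjacency of [a 2] and [a 3] falls below the antidiagonal. *)
Lemma two_cycles_rank_long (R : numFieldType) (n : nat)
    (G : signed_graph 'I_n) p q (a b : nat -> 'I_n) :
  two_cycles G p q a b -> 5 <= p -> 6 <= \rank (adjacency R G).
Proof.
case=> [[p3 q3] ab0 ha hb hab] p5.
by apply: (@rank_ge6 _ _ _ (a 1) (a 4) (b 1) (a 2) (a 3) (b 2));
  rewrite ?hab ?ha ?hb ?modS_if //; do ?case: ifP; lia.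
Qed.

Lemma two_cycles_rank_pendant (R : numFieldType) (n : nat)
    (G : signed_graph 'I_n) p q (a b : nat -> 'I_n) u w :
  two_cycles G p q a b -> u < p -> adj G w (a u) ->
  (forall k, k < p -> k != u -> ~~ adj G w (a k)) ->
  (forall l, 0 < l < q -> ~~ adj G w (b l)) -> 6 <= \rank (adjacency R G).
Proof.
case=> [[p3 q3] ab0 ha hb hab] up wu wa wb.
(* An edge of C_p avoiding [a u]. Here [x] is nonzero so that [a x] is adjacent to neither [b 1] nor
   [b 2], while [y] may be 0. *)
have [x [y [xp yp xy xu yu]]] : exists x y, [/\ 0 < x < p, y < p,
    (y == x.+1 %% p) || (x == y.+1 %% p), x != u & y != u].
  case: u up {wu wa} => [|[|u]] up.
  - by exists 1, 2; split; rewrite ?modS_if; do ?case: ifP; lia.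
  - have [p_eq3|p_neq3] := eqVneq p 3; first by exists 2, 0; rewrite p_eq3.
    by exists 2, 3; split; rewrite ?(@modn_small 3); lia.
  - by exists 1, 0; split; rewrite ?(@modn_small 1) //; lia.
have [_ xp'] := andP xp.
by apply: (@rank_ge6 _ _ _ w (a x) (b 1) (a u) (a y) (b 2));
  rewrite ?ha ?xy ?hb ?wa ?wb ?hab ?modS_if //; do ?case: ifP; lia.
Qed.

(** * Coordinates on the graph oo(p,q,1) *)

Lemma infty_inl_inj p q (i0 : 'I_p) : injective (infty_inl q i0).
Proof.
move=> i i'; rewrite /infty_inl.
by case: unliftP => [k|] ->; case: unliftP => [k'|] -> //= [->].
Qed.

Lemma infty_inr_inj p q (j0 : 'I_q) : injective (infty_inr p j0).
Proof.
move=> i i'; rewrite /infty_inr.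
by case: unliftP => [k|] ->; case: unliftP => [k'|] -> //= [->].
Qed.

Lemma infty_inlr p q (i0 i : 'I_p) (j0 j : 'I_q) :
  (infty_inl q i0 i == infty_inr p j0 j) = (i == i0) && (j == j0).
Proof.
rewrite /infty_inl /infty_inr; case: unliftP => [k|] ->;
  case: unliftP => [k'|] -> /=; rewrite ?eqxx //=.
- by rewrite [lift _ _ == _]eq_sym (negPf (neq_lift _ _)).
- by rewrite [lift _ _ == _]eq_sym (negPf (neq_lift _ _)).
- by rewrite [lift _ _ == _]eq_sym (negPf (neq_lift _ _)).
Qed.

Lemma infty_vertexP p q (i0 : 'I_p) (j0 : 'I_q) (s : infty_vertex p q) :
  (exists i, s = infty_inl q i0 i) \/ (exists j, s = infty_inr p j0 j).
Proof.
case: s => [[k|k]|].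
- by left; exists (lift i0 k); rewrite /infty_inl liftK.
- by right; exists (lift j0 k); rewrite /infty_inr liftK.
- by left; exists i0; rewrite /infty_inl unlift_none.
Qed.

Lemma Cadj_irr p (i : 'I_p) : 1 < p -> Cadj i i = false.
Proof. by move=> p1; rewrite /Cadj /= orbb modS_if //; case: ifP; lia. Qed.

Lemma infty_adj_inl p q (i0 i i' : 'I_p) (j0 : 'I_q) : 1 < q ->
  infty_adj i0 j0 (infty_inl q i0 i) (infty_inl q i0 i') = Cadj i i'.
Proof.
move=> q1; apply/orP/idP => [[]|ii'].
- move=> /existsP[k /existsP[k' /and3P[kk']]].
  by rewrite !(inj_eq (@infty_inl_inj _ _ _)) => /eqP <- /eqP <-.
- move=> /existsP[k /existsP[k' /and3P[kk']]].
  rewrite ![infty_inr _ _ _ == _]eq_sym !infty_inlr.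
  by move=> /andP[_ /eqP ek] /andP[_ /eqP ek']; rewrite ek ek' Cadj_irr in kk'.
- by left; apply/existsP; exists i; apply/existsP; exists i'; rewrite ii' !eqxx.
Qed.

Lemma infty_adj_inr p q (i0 : 'I_p) (j0 j j' : 'I_q) : 1 < p ->
  infty_adj i0 j0 (infty_inr p j0 j) (infty_inr p j0 j') = Cadj j j'.
Proof.
move=> p1; apply/orP/idP => [[]|jj'].
- move=> /existsP[k /existsP[k' /and3P[kk']]].
  rewrite !infty_inlr.
  by move=> /andP[/eqP ek _] /andP[/eqP ek' _]; rewrite ek ek' Cadj_irr in kk'.
- move=> /existsP[k /existsP[k' /and3P[kk']]].
  by rewrite !(inj_eq (@infty_inr_inj _ _ _)) => /eqP <- /eqP <-.
- by right; apply/existsP; exists j; apply/existsP; exists j'; rewrite jj' !eqxx.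
Qed.

Lemma infty_adj_inlr p q (i0 i : 'I_p) (j0 j : 'I_q) : i != i0 -> j != j0 ->
  infty_adj i0 j0 (infty_inl q i0 i) (infty_inr p j0 j) = false.
Proof.
move=> ii0 jj0; apply/negP => /orP[] /existsP[k /existsP[k' /and3P[_]]].
  by move=> _; rewrite infty_inlr (negPf jj0) andbF.
by rewrite eq_sym infty_inlr (negPf ii0).
Qed.

(** Iterating [ordS] walks around the cycle; started at the glued vertex, it gives the enumeration
    required by [two_cycles]. *)
Lemma val_iter_ordS p (i : 'I_p) k : iter k (@ordS p) i = (i + k) %% p :> nat.
Proof.
elim: k => [|k IHk] /=; first by rewrite addn0 modn_small.
by rewrite IHk -addn1 modnDml addn1 addnS.
Qed.

Lemma iter_ordS_eq p (i : 'I_p) k l : k < p -> l < p ->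
  (iter k (@ordS p) i == iter l (@ordS p) i) = (k == l).
Proof.
by move=> kp lp; rewrite -val_eqE /= !val_iter_ordS eqn_modDl !modn_small.
Qed.

Lemma iter_ordSP p (i i' : 'I_p) : exists2 k, k < p & i' = iter k (@ordS p) i.
Proof.
have p0 : 0 < p by case: p i {i'} => // -[].
exists ((i' + (p - i)) %% p); first by rewrite ltn_mod.
apply/val_inj; rewrite /= val_iter_ordS modnDmr addnCA subnKC; last exact: ltnW.
by rewrite modnDr modn_small.
Qed.

Lemma Cadj_iter_ordS p (i : 'I_p) k l : k < p -> l < p ->
  Cadj (iter k (@ordS p) i) (iter l (@ordS p) i)
  = (l == k.+1 %% p) || (k == l.+1 %% p).
Proof.
move=> kp lp.
have step m m' : m' < p ->
    (iter m' (@ordS p) i == (iter m (@ordS p) i).+1 %% p :> nat)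
    = (m' == m.+1 %% p).
  move=> m'p; rewrite !val_iter_ordS -addn1 modnDml -addnA addn1 eqn_modDl.
  by rewrite modn_small.
by rewrite /Cadj /= !step.
Qed.

Lemma Bpp_rank_ge6 (R : numFieldType) (n : nat) (G : signed_graph 'I_n) :
  8 <= n -> Bpp G -> 6 <= \rank (adjacency R G).
Proof.
move=> n8 [_ [p [q [i0 [j0 [p3 q3 [f [r [fK fadj radj rtree]]]]]]]]].
pose a k := f (infty_inl q i0 (iter k (@ordS p) i0)).
pose b k := f (infty_inr p j0 (iter k (@ordS q) j0)).
have [p0 q0] : 0 < p /\ 0 < q by lia.
have a0 k : 0 < k < p -> iter k (@ordS p) i0 != i0.
  by case/andP=> k0 kp; rewrite -[X in _ != X]/(iter 0 (@ordS p) i0) iter_ordS_eq; lia.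
have b0 k : 0 < k < q -> iter k (@ordS q) j0 != j0.
  by case/andP=> k0 kp; rewrite -[X in _ != X]/(iter 0 (@ordS q) j0) iter_ordS_eq; lia.
have ab : two_cycles G p q a b.
  split=> //; first by congr f; apply/eqP; rewrite infty_inlr !eqxx.
  - by move=> k l kp lp; rewrite fadj infty_adj_inl ?Cadj_iter_ordS //; lia.
  - by move=> k l kp lp; rewrite fadj infty_adj_inr ?Cadj_iter_ordS //; lia.
  - by move=> k l kp lp; rewrite fadj infty_adj_inlr ?a0 ?b0.
have [/forallP core|] := boolP [forall x, f (r x) == x].
  have : #|'I_n| = #|{: infty_vertex p q}|.
    apply: bij_eq_card; exists f => // x; exact/eqP.
  rewrite card_ord card_option card_sum !card_ord => en.
  have [p5|p4] := leqP 5 p; first exact: two_cycles_rank_long ab p5.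
  by apply: two_cycles_rank_long (two_cyclesC ab) _; lia.
rewrite negb_forall => /existsP[x xfr].
have [_ conn _] := rtree (r x).
(* The first step of a path from the root [f (r x)] to [x] inside its tree gives a tree vertex [w]
   adjacent to the root. *)
have {conn}/connectP[c] : connect [rel u v | [&& u \in [set y | r y == r x],
   v \in [set y | r y == r x] & adj G u v]] (f (r x)) x.
  by apply: conn; rewrite inE ?fK.
case: c => [_ /= ex|w c /= /andP[/and3P[_ + fw] _] _].
  by rewrite -ex eqxx in xfr.
rewrite inE => /eqP rw {xfr c}.
(* An edge between different fibres of [r] joins core vertices, so [w] would be the root itself, to
   which it is adjacent. *)
have wcore t : t != r x -> ~~ adj G w (f t).
  move=> tx; apply/negP => /radj; rewrite fK rw => -[et|[ew _]].
    by rewrite et eqxx in tx.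
  by rewrite ew adj_irr in fw.
have [[i ei]|[j ej]] := infty_vertexP i0 j0 (r x).
- have [u up eu] := iter_ordSP i0 i.
  apply: (two_cycles_rank_pendant _ ab up (w := w)).
  + by rewrite adj_sym /a -eu -ei.
  + move=> k kp ku; apply: wcore.
    by rewrite ei eu (inj_eq (@infty_inl_inj _ _ _)) iter_ordS_eq.
  + move=> l lq; apply: wcore; rewrite ei eq_sym infty_inlr negb_and.
    by rewrite b0 ?orbT.
- have [u up eu] := iter_ordSP j0 j.
  apply: (two_cycles_rank_pendant _ (two_cyclesC ab) up (w := w)).
  + by rewrite adj_sym /b -eu -ej.
  + move=> k kp ku; apply: wcore.
    by rewrite ej eu (inj_eq (@infty_inr_inj _ _ _)) iter_ordS_eq.
  + move=> l lq; apply: wcore; rewrite ej infty_inlr negb_and.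
    by rewrite a0.
Qed.

(** * Graphs of every rank *)

(* Two triangles 4,0,1 and 4,2,3, the path 4, 5, ..., m and further leaves
   m+1, m+2, ... hanging, like m, at m-1. Every edge is negative. *)
Definition broom_up (m x y : nat) : bool :=
  (x < y) && [|| y == 4, [&& y < 4, odd y & x == y.-1]
               | (4 < y) && (x == (minn y m).-1)].

Definition broom_adj (m x y : nat) : bool := broom_up m x y || broom_up m y x.

Lemma broom_adj_sym m n : symmetric (fun x y : 'I_n => broom_adj m x y).
Proof. by move=> x y; rewrite /broom_adj orbC. Qed.

Lemma broom_adj_irr m n : irreflexive (fun x y : 'I_n => broom_adj m x y).
Proof. by move=> x; rewrite /broom_adj /broom_up ltnn. Qed.

Definition broom (m n : nat) : signed_graph 'I_n :=
  SignedGraph (SGraph (@broom_adj_sym m n) (@broom_adj_irr m n)) xpredT.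

Lemma broom_up_gt4 m x y : 4 < y -> broom_up m x y = (x == (minn y m).-1).
Proof.
move=> y4; rewrite /broom_up y4 (gtn_eqF y4) [y < 4]ltnNge (ltnW y4) /=.
by apply: andb_idl => /eqP ->; lia.
Qed.

Lemma broom_up_4 m x : broom_up m x 4 = (x < 4).
Proof. by rewrite /broom_up /= andbT. Qed.

Lemma broom_up_lt4 m x y : y < 4 -> broom_up m x y = odd y && (x == y.-1).
Proof.
rewrite /broom_up; case: y => [|[|[|[|//]]]] _ //=; rewrite ?andbF ?orbF //;
  by apply: andb_idl => /eqP ->.
Qed.

Lemma broom_adj_gt4 m x y : 4 < y ->
  broom_adj m x y
  = (x == (minn y m).-1) || (y < x) && (y == (minn x m).-1).
Proof.
move=> y4; rewrite /broom_adj broom_up_gt4 //; congr (_ || _).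
have [yx|xy] := ltnP y x; first by rewrite broom_up_gt4 // (ltn_trans y4).
by rewrite /broom_up ltnNge xy.
Qed.

(** The last disjunct is the case m = 5, in which all leaves hang at the common vertex 4. *)
Lemma broom_adj_le4 m x y : 4 < m -> y <= 4 ->
  broom_adj m x y
  = (x <= 4) && broom_adj m x y || (x == 5) && (y == 4)
    || [&& 5 < x, m < 6 & y == 4].
Proof.
move=> m4 y4; have [//|x4] := leqP x 4; first by case: (broom_adj _ _ _); lia.
rewrite /broom_adj [broom_up m y x]broom_up_gt4 // /broom_up.
by rewrite ltnNge (ltnW (leq_ltn_trans y4 x4)) /=; lia.
Qed.

Lemma broom_adj_minn m x y : 4 < m ->
  broom_adj m (minn x m) y = broom_adj m x y.
Proof.
move=> m4; have [//|mx] := leqP x m; have x4 := ltn_trans m4 mx.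
rewrite /broom_adj ![broom_up m y _]broom_up_gt4 // minnn (minn_idPr (ltnW mx)).
have [y4|y4|->] := ltngtP y 4.
- by rewrite !broom_up_lt4 //; case: (odd y); lia.
- by rewrite !broom_up_gt4 //; lia.
- by rewrite !broom_up_4; lia.
Qed.

(** The triangle 0, 1, 4 has three negative edges. *)
Lemma broom_unbalanced m n : 4 < n -> unbalanced (broom m n.+1).
Proof.
move=> n5 /(_ [:: inord 0; inord 1; inord 4]); rewrite /positive_cycle.
rewrite count_predT size_map /=; suff -> : is_cycle (broom m n.+1)
    [:: inord 0; inord 1; inord 4] by move=> /(_ isT).
rewrite /is_cycle /ucycleb /= /broom_adj !inE -!val_eqE /= !inordK //; lia.
Qed.

(** * Kernel of the broom without duplicate leaves *)

Section BroomRank.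
Variables (R : numFieldType) (m : nat) (z : nat -> R).
Hypothesis m4 : 4 < m.
(** The kernel equations on the vertices 0, ..., m, with the common sign of all edges dropped. *)
Hypothesis ker_z :
  forall j, j <= m -> (\sum_(0 <= i < m.+1 | broom_adj m i j) z i = 0)%R.

Lemma broom_kernel_nbhd j s : j <= m -> uniq s ->
  (forall i, (i \in s) = (i <= m) && broom_adj m i j) ->
  (\sum_(i <- s) z i = 0)%R.
Proof.
move=> jm us sE; apply: etrans (ker_z jm); rewrite -[RHS]big_filter.
apply: perm_big.
apply: uniq_perm => //; first by rewrite filter_uniq ?iota_uniq.
by move=> i; rewrite sE mem_filter mem_index_iota andbC.
Qed.

Lemma broom_kernel_last : z m.-1 = 0%R.
Proof.
have := @broom_kernel_nbhd m [:: m.-1]; rewrite big_seq1; apply=> // i.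
by rewrite inE broom_adj_gt4 //; lia.
Qed.

Lemma broom_kernel_path j : 4 < j < m -> (z j.-1 + z j.+1 = 0)%R.
Proof.
move=> jm; have := @broom_kernel_nbhd j [:: j.-1; j.+1].
rewrite !big_cons big_nil addr0; apply; first by lia.
  by rewrite /= !inE; lia.
by move=> i; rewrite !inE broom_adj_gt4; lia.
Qed.

(** The equation at each of 0, ..., 3 fixes the value at its triangle partner; the equation at 4
    then gives [z 5]. *)
Lemma broom_kernel_core :
  [/\ z 0 = - z 4, z 1 = - z 4, z 2 = - z 4, z 3 = - z 4 & z 5 = z 4 *+ 4]%R.
Proof.
have m1 := ltnW m4; have m2 := ltnW m1; have m3 := ltnW m2; have m0 := ltnW m3.
have nbhd j k : j <= 4 -> (k <= m) && broom_adj m k j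
    = (k <= 4) && broom_adj m k j || (k == 5) && (j == 4).
  by move=> j4; rewrite broom_adj_le4 //; lia.
have core j s : j <= 4 -> uniq s ->
    (forall i, (i \in s) = (i <= m) && broom_adj m i j) ->
    (\sum_(i <- s) z i = 0)%R.
  by move=> j4; apply: broom_kernel_nbhd; lia.
have core2 j i : j < 4 -> i < 4 -> (forall k, (k == i) || (k == 4) =
    (k <= m) && broom_adj m k j) -> (z i = - z 4)%R.
  move=> j4 i4 h; apply/eqP; rewrite -addr_eq0; apply/eqP.
  have := @core j [:: i; 4]; rewrite !big_cons big_nil addr0; apply.
  - exact: ltnW.
  - by rewrite /= inE; lia.
  - by move=> k; rewrite !inE.
have e0 : (z 0 = - z 4)%R.
  by apply: (@core2 1) => // -[|[|[|[|[|k]]]]]; rewrite nbhd ?orbF ?andbF //; lia.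
have e1 : (z 1 = - z 4)%R.
  by apply: (@core2 0) => // -[|[|[|[|[|k]]]]]; rewrite nbhd ?orbF ?andbF //; lia.
have e2 : (z 2 = - z 4)%R.
  by apply: (@core2 3) => // -[|[|[|[|[|k]]]]]; rewrite nbhd ?orbF ?andbF //; lia.
have e3 : (z 3 = - z 4)%R.
  by apply: (@core2 2) => // -[|[|[|[|[|k]]]]]; rewrite nbhd ?orbF ?andbF //; lia.
split=> //; have := @core 4 [:: 0; 1; 2; 3; 5].
rewrite !big_cons big_nil addr0 e0 e1 e2 e3 => h.
have {h} : (- z 4 + (- z 4 + (- z 4 + (- z 4 + z 5))) = 0)%R.
  apply: h => // -[|[|[|[|[|k]]]]]; rewrite nbhd ?orbF ?andbF //; lia.
rewrite !addrA -!opprD => /eqP; rewrite addrC subr_eq0 => /eqP ->.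
by rewrite -!addrA.
Qed.

Lemma broom_kernel_trivial j : j <= m -> z j = 0%R.
Proof.
have [e0 e1 e2 e3 e5] := broom_kernel_core.
(* Path equations carry [z m.-1 = 0] backwards, two steps at a time. *)
have back k : 2 * k + 5 <= m -> z (m.-1 - 2 * k) = 0%R.
  elim: k => [|k IHk] km; first by rewrite subn0 broom_kernel_last.
  have := @broom_kernel_path (m.-1 - 2 * k).-1.
  have -> : (m.-1 - 2 * k).-1.+1 = m.-1 - 2 * k by lia.
  have -> : (m.-1 - 2 * k).-2 = m.-1 - 2 * k.+1 by lia.
  by rewrite IHk ?addr0; last lia; apply; lia.
(* By parity the descent ends at 4 or at 5; in the latter case [z 5 = z 4 *+ 4] and characteristic
   zero conclude. *)
have z4 : z 4 = 0%R.
  have [om|em] := boolP (odd m).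
    have := back (m - 5)./2; have -> : m.-1 - 2 * (m - 5)./2 = 4 by lia.
    by apply; lia.
  have := back (m - 6)./2; have -> : m.-1 - 2 * (m - 6)./2 = 5 by lia.
  rewrite e5 => /(_ ltac:(lia))/eqP.
  by rewrite mulrn_eq0 => /eqP.
have fwd k : k + 5 <= m -> z (k + 4) = 0%R /\ z (k + 5) = 0%R.
  elim: k => [|k IHk] km; first by rewrite !add0n e5 z4 mul0rn.
  have [h4 h5] := IHk (ltnW km); rewrite !addSnnS; split=> //.
  have := @broom_kernel_path (k + 5); rewrite -[(k + 5).+1]addnS.
  have -> : (k + 5).-1 = k + 4 by lia.
  by rewrite h4 add0r; apply; lia.
case: j => [|[|[|[|j]]]] jm; rewrite ?e0 ?e1 ?e2 ?e3 ?z4 ?oppr0 //.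
case: j jm => [//|j] jm; have [] := fwd j; first by lia.
by rewrite !addnS addn0.
Qed.

End BroomRank.

Lemma broom_rank (R : numFieldType) (m n : nat) : 4 < m <= n ->
  \rank (adjacency R (broom m n.+1)) = m.+1.
Proof.
case/andP=> m4 mn; set A := adjacency _ _.
pose g : 'I_m.+1 -> 'I_n.+1 := widen_ord (mn : m < n.+1).
pose h (i : 'I_n.+1) : 'I_m.+1 := inord (minn i m).
apply/eqP; rewrite eqn_leq; apply/andP; split.
  (* Upper bound: [h] folds the duplicate leaves onto [m], so every row occurs among the first m +
     1. *)
  have -> : A = rowsub (g \o h) A.
    apply/matrixP => i j; rewrite !mxE /= /h inordK ?ltnS ?geq_minr //.
    by rewrite broom_adj_minn.
  by rewrite (leq_trans (mxrankS (rowsub_comp_sub _ _ _))) // rank_leq_row.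
(* Lower bound: the principal submatrix on 0, ..., m has trivial kernel. *)
apply: leq_trans (rank_mxsub g g A).
suff /eqP -> : row_free (mxsub g g A) by [].
apply: inj_row_free => v vA; apply/rowP => j; rewrite mxE.
pose z k : R := v 0%R (inord k).
have -> : v 0%R j = z j by rewrite /z inord_val.
apply: (@broom_kernel_trivial R m z) => //; last by rewrite -ltnS.
move=> k km; have /matrixP/(_ 0%R (inord k)) := vA; rewrite !mxE => vk.
rewrite big_mkord big_mkcond /=; apply/eqP; rewrite -oppr_eq0; apply/eqP.
rewrite -[RHS]vk -sumrN; apply: eq_bigr => i _.
rewrite !mxE /= inordK //; case: ifP => _; last by rewrite oppr0 mulr0.
by rewrite expr1 mulrN1 /z inord_val.
Qed.

(** * Connectedness and acyclicity by descending labels *)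

Lemma connect_descending n (e : rel 'I_n) (c : 'I_n) (A : {pred 'I_n}) :
  (forall x, x \in A -> x != c -> exists2 y : 'I_n, y \in A & y < x /\ e x y) ->
  {in A, forall x, connect e x c}.
Proof.
move=> desc x; have [k] := ubnP (val x); elim: k x => // k IHk x xk xA.
have [->|xc] := eqVneq x c; first exact: connect0.
have [y yA [yx exy]] := desc x xA xc.
apply: connect_trans (connect1 exy) (IHk y _ yA).
exact: leq_trans yx xk.
Qed.

(* Orienting every edge towards its larger end, the maximum of a cycle would
   have two distinct smaller neighbours. *)
Lemma no_cycle_descending n (G : sgraph 'I_n) (A : {set 'I_n}) (par : nat -> nat) :
  (forall x y, x \in A -> y \in A -> adj G x y -> x < y -> x = par y :> nat) ->
  forall c : seq 'I_n, is_cycle G c -> ~~ all [in A] c.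
Proof.
move=> parP c /andP[/andP[cyc uc] sc]; apply/negP => /allP cA.
have [x0 x0c] : exists x0, x0 \in c by case: c sc {cyc uc cA} => // x0; exists x0; rewrite mem_head.
case: (@arg_maxnP _ x0 (mem c) val x0c) => x xc xmax.
have [i c' ec] := rot_to xc.
have cE y : (y \in c) = (y \in x :: c') by rewrite -ec mem_rot.
move: cyc uc sc; rewrite -(rot_cycle i) -(rot_uniq i) -(size_rot i) ec.
case: c' => [|y [|z c']] // in ec cE *; set l := last z c'.
rewrite /= rcons_path -/l => /andP[xy /andP[_ /andP[_ lx]]] ul _.
have nbr t : t \in c -> t != x -> adj G t x -> t = par x :> nat.
  move=> tc tx etx; apply: parP => //; [exact: cA|exact: cA|].
  by rewrite ltn_neqAle val_eqE tx; apply: xmax.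
have lz : l \in z :: c' by apply: mem_last.
have yl : y = l.
  apply: val_inj; rewrite /= (nbr y) ?(nbr l) //.
  - by rewrite cE !inE; move: lz; rewrite inE => ->; rewrite !orbT.
  - by apply: contraTneq ul => <-; rewrite inE lz orbT.
  - by rewrite cE !inE eqxx orbT.
  - by apply: contraTneq ul => ->; rewrite mem_head.
  - by rewrite adj_sym.
by move: ul; rewrite yl lz /= andbF.
Qed.

Lemma infty_adj_sym p q (i0 : 'I_p) (j0 : 'I_q) : symmetric (infty_adj i0 j0).
Proof.
have sub s t : infty_adj i0 j0 s t -> infty_adj i0 j0 t s.
  case/orP=> /existsP[k /existsP[l /and3P[kl es et]]]; apply/orP; [left|right];
    apply/existsP; exists l; apply/existsP; exists k; rewrite es et !andbT;
    by move: kl; rewrite /Cadj /= orbC.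
by move=> s t; apply/idP/idP; apply: sub.
Qed.

(** * Membership of the broom in the class *)

Section BroomBpp.
Variables m n : nat.
Hypotheses (m4 : 4 < m) (n4 : 4 <= n).
Let G := broom m n.+1.

Lemma broom_up_edges :
  #|edges G| = #|[set z : 'I_n.+1 * 'I_n.+1 | broom_up m z.1 z.2]|.
Proof.
rewrite -(card_in_imset (f := fun z : _ * _ => [set z.1; z.2])).
  congr #|pred_of_set _|; apply/setP => e; apply/idP/imsetP.
  - rewrite inE => /existsP[x /existsP[y /andP[/orP[xy|yx] /eqP ->]]].
      by exists (x, y); rewrite ?inE.
    by exists (y, x); rewrite ?inE // setUC.
  - case=> -[x y]; rewrite inE => xy ->; rewrite inE; apply/existsP; exists x.
    by apply/existsP; exists y; rewrite /= /broom_adj xy eqxx.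
move=> [x y] [x' y']; rewrite !inE /= => /andP[xy _] /andP[xy' _] /setP e.
have := e x; have := e y; have := e x'; have := e y'.
rewrite !inE -!val_eqE !eqxx /= => h1 h2 h3 h4.
by congr pair; apply: val_inj => /=; lia.
Qed.

Lemma card_broom_up (y : 'I_n.+1) : #|[set x : 'I_n.+1 | broom_up m x y]|
  = if y == 4 :> nat then 4 else if y < 4 then odd y : nat else 1.
Proof.
have [y4|y4|->] := ltngtP y 4.
- case: (boolP (odd y)) => oy; last first.
    by apply: eq_card0 => x; rewrite inE broom_up_lt4 // (negPf oy).
  rewrite -[RHS](cards1 (inord y.-1 : 'I_n.+1)); apply: eq_card => x.
  by rewrite !inE broom_up_lt4 // oy -val_eqE /= inordK //; lia.
- rewrite -[RHS](cards1 (inord (minn y m).-1 : 'I_n.+1)); apply: eq_card => x.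
  by rewrite !inE broom_up_gt4 // -val_eqE /= inordK //; have := ltn_ord y; lia.
- rewrite -sum1_card (eq_bigl (fun x : 'I_n.+1 => x < 4)); last first.
    by move=> x; rewrite inE broom_up_4.
  by rewrite -(big_ord_widen n.+1 (fun=> 1)) ?sum1_card ?card_ord // ltnW.
Qed.

(** Counting by larger end, vertices 0 to 4 contribute 0 + 1 + 0 + 1 + 4 = 6 edges and each of the n
    - 4 later vertices contributes 1. *)
Lemma broom_card_edges : #|edges G| = n.+1 + 1.
Proof.
rewrite broom_up_edges -sum1dep_card.
rewrite -(pair_big_dep xpredT (fun x y : 'I_n.+1 => broom_up m x y) (fun _ _ => 1)) /=.
rewrite (exchange_big_dep xpredT) //=.
rewrite (eq_bigr (fun y : 'I_n.+1 =>
    if y == 4 :> nat then 4 else if y < 4 then odd y : nat else 1)); last first.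
  by move=> y _; rewrite -card_broom_up -sum1dep_card.
rewrite -(big_mkord xpredT (fun y => if y == 4 then 4 else if y < 4 then odd y : nat else 1)).
rewrite (big_cat_nat (n := 5)) //= [X in _ + X](eq_big_nat _ _ (F2 := fun=> 1)); last first.
  by move=> y /andP[y4 _]; rewrite (gtn_eqF y4) ltnNge (ltnW y4).
by rewrite sum_nat_const_nat /index_iota /= !big_cons big_nil /=; lia.
Qed.

(** These vertices form the tree attached at 4; each one past 4 has the smaller neighbour
    [(minn x m).-1], so descent reaches 4. *)
Lemma broom_branch_connected (x y : 'I_n.+1) : 4 <= x -> 4 <= y ->
  connect [rel u v : 'I_n.+1 | [&& 4 <= u, 4 <= v & adj G u v]] x y.
Proof.
set e : rel 'I_n.+1 := (X in connect X).
have esym : symmetric e by move=> u v; rewrite /e /= andbCA broom_adj_sym.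
suff root (z : 'I_n.+1) : 4 <= z -> connect e z (inord 4).
  move=> x4 y4; apply: connect_trans (root x x4) _.
  by rewrite (sym_connect_sym esym) root.
move: z; apply: (@connect_descending _ e _ [pred z : 'I_n.+1 | 4 <= z]) => x'.
rewrite inE -val_eqE /= inordK // => x4 xn4; have x5 : 4 < x' by lia.
have xn := ltn_ord x'.
have iE : (inord (minn x' m).-1 : 'I_n.+1) = (minn x' m).-1 :> nat.
  by rewrite inordK //; lia.
exists (inord (minn x' m).-1); first by rewrite inE iE; lia.
rewrite iE; split; first by lia.
apply/and3P; rewrite iE; split; [lia|lia|].
by rewrite /= /broom_adj [broom_up _ _ x']broom_up_gt4 // iE eqxx orbT.
Qed.

Lemma broom_connected (x y : 'I_n.+1) : connect (adj G) x y.
Proof.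
have esym : connect_sym (adj G) by apply: sym_connect_sym; apply: adj_sym.
suff root z : connect (adj G) z (inord 4).
  by apply: connect_trans (root x) _; rewrite esym.
have [z4|z4] := ltnP z 4.
  by apply: connect1; rewrite /= /broom_adj inordK // broom_up_4 z4.
apply: (connect_sub _ (broom_branch_connected z4 _)); last by rewrite inordK.
by move=> u v /and3P[_ _ /connect1].
Qed.

(** Places oo(3,3,1) on the vertices 0, ..., 4, the merged vertex going to 4. *)
Definition core_val (s : infty_vertex 3 3) : nat :=
  match s with Some (inl i) => i | Some (inr j) => 2 + j | None => 4 end.

(** Inverts [core_val] on 0, ..., 4 and sends every later vertex to the merged one, the root of the
    attached tree. *)
Definition core_of (x : nat) : infty_vertex 3 3 :=
  if x < 2 then Some (inl (inord x : 'I_2))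
  else if x < 4 then Some (inr (inord (x - 2) : 'I_2)) else None.

Lemma core_val_le4 s : core_val s <= 4.
Proof. by case: s => [[[[|[|]]]|[[|[|]]]]|]. Qed.

Lemma core_valK : cancel core_val core_of.
Proof.
case=> [[i|j]|] //=; rewrite /core_of.
  by rewrite ltn_ord inord_val.
by rewrite addKn inord_val; case: j => [[|[|]]].
Qed.

Lemma core_ofK x : x <= 4 -> core_val (core_of x) = x.
Proof.
by move: x => [|[|[|[|[|]]]]] // _; rewrite /core_of /= inordK.
Qed.

Lemma core_of_ge4 x : 4 <= x -> core_of x = None.
Proof. by move: x => [|[|[|[|]]]]. Qed.

Lemma core_val_inl (i : 'I_3) :
  core_val (infty_inl 3 ord0 i) = if i == ord0 then 4 else i.-1.
Proof.
by rewrite /infty_inl; case: unliftP => [k|] ->.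
Qed.

Lemma core_val_inr (j : 'I_3) :
  core_val (infty_inr 3 ord0 j) = if j == ord0 then 4 else j.+1.
Proof.
by rewrite /infty_inr; case: unliftP => [k|] ->.
Qed.

Lemma broom_core_adj s t :
  broom_adj m (core_val s) (core_val t)
  = infty_adj (ord0 : 'I_3) (ord0 : 'I_3) s t.
Proof.
have lr i j : broom_adj m (core_val (infty_inl 3 ord0 i))
    (core_val (infty_inr 3 ord0 j)) = infty_adj (ord0 : 'I_3) (ord0 : 'I_3)
    (infty_inl 3 ord0 i) (infty_inr 3 ord0 j).
  have inl0 : infty_inl 3 (ord0 : 'I_3) ord0 = infty_inr 3 (ord0 : 'I_3) ord0.
    by apply/eqP; rewrite infty_inlr !eqxx.
  have [->|i0] := eqVneq i ord0.
    rewrite inl0 infty_adj_inr // !core_val_inr.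
    by case: j => [[|[|[|//]]] ?].
  have [->|j0] := eqVneq j ord0.
    rewrite -inl0 infty_adj_inl // !core_val_inl.
    by case: i {i0} => [[|[|[|//]]] ?].
  rewrite infty_adj_inlr // core_val_inl core_val_inr (negPf i0) (negPf j0).
  by case: i i0 => [[|[|[|//]]] ?] //; case: j j0 => [[|[|[|//]]] ?].
have [[i ->]|[i ->]] := infty_vertexP (ord0 : 'I_3) (ord0 : 'I_3) s;
  have [[j ->]|[j ->]] := infty_vertexP (ord0 : 'I_3) (ord0 : 'I_3) t.
- rewrite infty_adj_inl // !core_val_inl.
  by case: i => [[|[|[|//]]] ?]; case: j => [[|[|[|//]]] ?].
- exact: lr.
- by rewrite infty_adj_sym -lr /broom_adj orbC.
- rewrite infty_adj_inr // !core_val_inr.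
  by case: i => [[|[|[|//]]] ?]; case: j => [[|[|[|//]]] ?].
Qed.

Lemma broom_up_core x y : broom_up m x y -> 4 < y -> 4 <= x.
Proof. by move=> + y4; rewrite broom_up_gt4 // => /eqP ->; lia. Qed.

Lemma broom_Bpp : Bpp G.
Proof.
split; first by split; [exact: broom_connected|rewrite broom_card_edges card_ord].
exists 3, 3, ord0, ord0; split=> //.
pose f s : 'I_n.+1 := inord (core_val s); pose r (x : 'I_n.+1) := core_of x.
have fE s : f s = core_val s :> nat.
  by rewrite /f inordK //; have := core_val_le4 s; lia.
have frK (x : 'I_n.+1) : x <= 4 -> x = f (r x).
  by move=> x4; apply: val_inj; rewrite /= fE core_ofK.
(* Since [r] is injective on 0, ..., 4, an edge inside a fibre has its larger end past 4. *)
have up_r (x y : 'I_n.+1) : broom_up m x y -> r x = r y -> 4 < y.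
  move=> xy rxy; rewrite ltnNge; apply/negP => y4; have /andP[xlty _] := xy.
  have := frK y y4; rewrite -rxy -frK => [yx|]; last exact: leq_trans (ltnW xlty) y4.
  by rewrite yx ltnn in xlty.
exists f, r; split.
- by move=> s; rewrite /r fE core_valK.
- by move=> s t; rewrite /= !fE broom_core_adj.
- have up (x y : 'I_n.+1) : broom_up m x y -> r x = r y \/ x = f (r x) /\ y = f (r y).
    move=> xy; have [y4|y4] := leqP y 4; last first.
      left; rewrite /r !core_of_ge4 ?(ltnW y4) //.
      exact: broom_up_core xy y4.
    right; split; apply: frK => //.
    by have /andP[xlty _] := xy; apply: leq_trans (ltnW xlty) y4.
  by move=> x y /orP[/up //|/up[->|[]]]; [left|right].
- move=> s; split.
  + by apply/set0Pn; exists (f s); rewrite inE /r fE core_valK.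
  + move=> x y; rewrite !inE => /eqP rx /eqP ry.
    case: s rx ry => [s|] rx ry.
      have small z : r z = Some s -> z = f (Some s).
        move=> rz; rewrite -rz; apply: frK; rewrite leqNgt.
        by apply/negP => z4; move: rz; rewrite /r core_of_ge4 // ltnW.
      by rewrite (small x) // (small y) // connect0.
    have big (z : 'I_n.+1) : r z = None -> 4 <= z.
      move=> rz; rewrite leqNgt; apply/negP => z4; have := frK z (ltnW z4).
      by move=> /(congr1 val) /=; rewrite rz fE /= => ez; rewrite ez in z4.
    apply: connect_sub (broom_branch_connected (big x rx) (big y ry)) => u v.
    case/and3P=> u4 v4 uv; apply: connect1.
    by rewrite /= !inE /r !core_of_ge4.
  (* A vertex past 4 has a single smaller neighbour. *)
  + apply: (@no_cycle_descending _ _ _ (fun y => (minn y m).-1)) => x y.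
    rewrite !inE => /eqP rx /eqP ry /orP[xy|/andP[yx _]] xlty; last first.
      by have := ltn_trans xlty yx; rewrite ltnn.
    have y4 : 4 < y by apply: up_r xy _; rewrite rx ry.
    by move: xy; rewrite broom_up_gt4 // => /eqP.
Qed.

End BroomBpp.

Theorem theorem5p6 (R : numFieldType) (n : nat) (hn : 8 <= n) (k : nat) :
  (exists G : signed_graph 'I_n,
     [/\ Bpp G, unbalanced G & nullity R G = k])
  <-> k <= n - 6.
Proof.
split=> [[G [bG _ <-]]|kn].
  by rewrite nullityE leq_sub2l // Bpp_rank_ge6.
(* After [n] is replaced by [n.+1], the choice m = n - k gives rank n - k + 1 on n + 1 vertices,
   hence nullity k; the bound on k gives m >= 5. *)
case: n hn kn => // n n8 kn; exists (broom (n - k) n.+1).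
split; [apply: broom_Bpp; lia|apply: broom_unbalanced; lia|].
by rewrite nullityE broom_rank; lia.
Qed.
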